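(* Let $I$ be a set, let $\tau\colon \mathbb{R}^I\to\mathbb{R}$ be a function and let $p\in[1,+\infty)$. The following conditions are equivalent. (1) $\tau$ preserves $p$-integrability over every finite measure space. (2) $\tau$ is $\mathrm{Cyl}(\mathbb{R}^I)$-measurable and there exist a finite subset $J\subseteq I$ and nonnegative real numbers $(\lambda_j)_{j\in J}$ and $k$ such that, for every $v\in\mathbb{R}^I$, $|\tau(v)|\leq k+\sum_{j\in J}\lambda_j|v_j|$.
   Context: The set $I$ may have any cardinality. $\mathrm{Cyl}(\mathbb{R}^I)$ is the smallest $\sigma$-algebra on $\mathbb{R}^I$ making every projection $\pi_i\colon\mathbb{R}^I\to\mathbb{R}$ ($i\in I$) measurable; $\mathbb{R}$ always carries its Borel $\sigma$-algebra. A measure space $(\Omega,\mathcal{F},\mu)$ is finite if $\mu(\Omega)<\infty$. $\mathcal{L}^p(\mu)$ is the set of $\mathcal{F}$-measurable functions $f\colon\Omega\to\mathbb{R}$ with $\int_\Omega|f|^p\,d\mu<\infty$ (actual functions, not classes). For a family $(f_i)_{i\in I}$ of functions $\Omega\to\mathbb{R}$, $\tau((f_i)_{i\in I})\colon\Omega\to\mathbb{R}$ is the function $x\mapsto\tau((f_i(x))_{i\in I})$. $\tau$ preserves $p$-integrability over $(\Omega,\mathcal{F},\mu)$ if $\tau((f_i)_{i\in I})\in\mathcal{L}^p(\mu)$ for every family $(f_i)_{i\in I}$ of elements of $\mathcal{L}^p(\mu)$. *)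

(* Defs.v *)
From HB Require Import structures.
From mathcomp Require Import all_boot all_order all_algebra.
From mathcomp Require Import finmap.
From mathcomp Require Import all_classical all_reals all_analysis.

Set Implicit Arguments.
Unset Strict Implicit.
Unset Printing Implicit Defensive.
Import Order.TTheory GRing.Theory Num.Theory.
Import numFieldNormedType.Exports.
Local Open Scope classical_set_scope.
Local Open Scope ring_scope.

(* The measurable sets of [cylType R I] are Cyl(R^I), the smallest sigma-algebra
   on R^I containing the preimages of the Borel sets under all projections. *)
Definition cyl_system (R : realType) (I : Type) : set (set (I -> R)) :=
  \bigcup_(i in [set: I]) preimage_set_system [set: I -> R]
    (fun v : I -> R => v i) (measurable : set (set R)).

Definition cylType (R : realType) (I : Type) :=
  g_sigma_algebraType (@cyl_system R I).

HB.instance Definition _ (R : realType) (I : Type) :=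
  Measurable.on (cylType R I).

Definition preserves_integrability (R : realType) (I : Type)
    (tau : (I -> R) -> R) (p : R) (d : measure_display) (T : measurableType d)
    (mu : {measure set T -> \bar R}) : Prop :=
  forall f : I -> T -> R, (forall i, f i \in Lfun mu p%:E) ->
    (fun x => tau (fun i => f i x)) \in Lfun mu p%:E.

(* [Lfun] bounds the Lp-norm, that is, the p-th root of the integral below. *)
Lemma LfunP_powR (R : realType) (d : measure_display) (T : measurableType d)
    (mu : {measure set T -> \bar R}) (p : R) (f : T -> R) : 1 <= p ->
  f \in Lfun mu p%:E <->
  measurable_fun [set: T] f /\ (\int[mu]_x (`|f x| `^ p)%:E < +oo)%E.
Proof.
move=> p1.
have p0 : 0 < p by exact: lt_le_trans p1.
have fin : finite_norm mu p%:E f <-> (\int[mu]_x (`|f x| `^ p)%:E < +oo)%E.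
  rewrite /finite_norm unlock.
  rewrite (eq_integral (fun x => (`|f x| `^ p)%:E)) //.
  have : (0 <= \int[mu]_x (`|f x| `^ p)%:E)%E.
    by apply: integral_ge0 => x _; rewrite lee_fin powR_ge0.
  case: (\int[mu]_x _)%E => [r| |] //= _.
    by rewrite !ltry.
  by rewrite invr_eq0 gt_eqF.
split=> [/andP[]|[mf If]].
  by rewrite !inE /= => mf /fin.
by apply/andP; split; rewrite inE//=; exact/fin.
Qed.

(* Main.v *)
(* Growth bound, from integrability: a cylinder-measurable tau depends on
   countably many coordinates only, so fix finite sets J_n exhausting them. If no
   bound of the required form holds, there are points v_n, vanishing at the other
   coordinates, with |tau(v_n)| > 2^n + 2^n * sum_(j in J_n) |v_n(j)|. On nat,
   give the point n the mass |tau(v_n)|^-p <= 2^-n: the measure is finite, each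
   coordinate n |-> v_n(i) is p-integrable since its n-th term is eventually at
   most 2^-n, but the integral of |tau(v_n)|^p is a sum of ones.
   The converse is domination. *)
Require Import Defs.
From HB Require Import structures.
From mathcomp Require Import all_boot all_order all_algebra.
From mathcomp Require Import finmap.
From mathcomp Require Import all_classical all_reals all_analysis.
From mathcomp Require Import measurable_realfun.

Set Implicit Arguments.
Unset Strict Implicit.
Unset Printing Implicit Defensive.
Import Order.TTheory GRing.Theory Num.Theory.
Import numFieldNormedType.Exports.
Local Open Scope classical_set_scope.
Local Open Scope ring_scope.

Lemma measurable_to_cyl (R : realType) (I : Type) (d : measure_display)
    (T : measurableType d) (f : I -> T -> R) :
  (forall i, measurable_fun [set: T] (f i)) ->
  measurable_fun [set: T] (fun x => (fun i => f i x) : cylType R I).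
Proof.
move=> mf; apply: (@measurability _ _ T (cylType R I) _ _ (@cyl_system R I)) => //.
by move=> _ [_ [i _ [B mB <-]] <-]; rewrite !setTI; have := mf i measurableT B mB;
  rewrite setTI.
Qed.

Lemma measurable_cyl_proj (R : realType) (I : Type) (i : I) :
  measurable_fun [set: cylType R I] (fun v : cylType R I => v i).
Proof.
move=> _ B mB; apply: sub_sigma_algebra; exists i => //.
by exists B => //; rewrite !setTI.
Qed.

(** The codomain [S] is left free so that sets, seen as [Prop]-valued functions, are covered too. *)
Definition determined_by (I R S : Type) (D : set I) (f : (I -> R) -> S) :=
  forall v w : I -> R, (forall i, D i -> v i = w i) -> f v = f w.

(** The sets determined by countably many coordinates form a sigma-algebra containing the
    generators: a countable union is determined by the union of the countable coordinate sets. *)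
Lemma cyl_countably_determined (R : realType) (I : Type) (A : set (I -> R)) :
  measurable (A : set (cylType R I)) ->
  exists2 D : set I, countable D & determined_by D A.
Proof.
move=> mA; suff /(_ A mA) : measurable `<=` [set A : set (cylType R I) |
    exists2 D : set I, countable D & determined_by D A] by [].
apply: smallest_sub => [|_ [i _ [B _ <-]]].
  split.
  - by exists set0.
  - move=> B [D cD DB]; exists D => // v w vw.
    by rewrite setTD /setC /= (DB v w vw).
  - move=> F /= DF.
    have /choice[D cD] : forall n, exists D, countable D /\ determined_by D (F n).
      by move=> n; have [D] := DF n; exists D.
    exists (\bigcup_n D n) => [|v w vw].
      by apply: bigcup_countable => // n _; have [] := cD n.
    apply/propext; split=> -[n _ Fn]; exists n => //; move: Fn;
      have [_ Dn] := cD n;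
      by rewrite (Dn v w) // => i Di; apply: vw; exists n.
exists [set i] => // v w vw.
by rewrite /setI /preimage /= (vw i).
Qed.

(** The sets [f < q] with [q] rational recover [f], and each of them depends on countably many
    coordinates. *)
Lemma measurable_countably_determined (R : realType) (I : Type)
    (f : (I -> R) -> R) :
  measurable_fun [set: cylType R I] (f : cylType R I -> R) ->
  exists2 D : set I, countable D & determined_by D f.
Proof.
move=> mf.
have /choice[D HD] : forall q : rat, exists D : set I, countable D /\
    determined_by D (f @^-1` [set` `]-oo, ratr q[ ]).
  move=> q; have [|D] := @cyl_countably_determined R I (f @^-1` [set` `]-oo, ratr q[ ]).
    by rewrite -[X in measurable X]setTI; apply: mf.
  by exists D.
(* If [f w < f v], a rational in between gives a sublevel set containing [w] but not [v]. The
   assumption is symmetric in [v] and [w], so equality follows. *)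
have Dle v w : (forall i, (\bigcup_q D q) i -> v i = w i) -> f v <= f w.
  move=> vw; rewrite leNgt; apply/negP => /rat_in_itvoo[q].
  rewrite in_itv /= => /andP[fwq qfv].
  have [_ /(_ v w) Dq] := HD q.
  have : (f @^-1` [set` `]-oo, ratr q[ ]) v.
    by rewrite Dq /= ?in_itv // => i Di; apply: vw; exists q.
  by rewrite /= in_itv /= ltNge (ltW qfv).
exists (\bigcup_q D q) => [|v w vw].
  by apply: bigcup_countable => // q _; have [] := HD q.
by apply/eqP; rewrite eq_le !Dle // => i /vw.
Qed.

(** [J n] collects the first [n] terms of a sequence reaching all of [D]; [{classic I}] provides the
    choice structure that finite sets require. *)
Lemma countable_fset_exhaustion (I : Type) (D : set I) : countable D ->
  exists J : nat -> {fset {classic I}},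
    forall i, D i -> exists N, forall n, (N <= n)%N -> (i : {classic I}) \in J n.
Proof.
move=> /pfcard_geP[->|/unsquash e]; first by exists (fun=> fset0).
exists (fun n => [fset (e k : {classic I}) | k in iota 0 n]%fset) => i Di.
have [k _ <-] := @surj _ _ _ _ e i Di.
exists k.+1 => n kn; apply/imfsetP; exists k => //=.
by rewrite mem_iota.
Qed.

Lemma eventually_le_geometric_summable (R : realType) (u : nat -> R) (N : nat) :
  (forall n, 0 <= u n) -> (forall n, (N <= n)%N -> u n <= 2^-1 ^+ n) ->
  (\sum_(n <oo) (u n)%:E < +oo)%E.
Proof.
move=> u0 uN; rewrite (@nneseries_split _ _ 0 N); last first.
  by move=> k _; rewrite lee_fin.
rewrite add0n lte_add_pinfty //; first by rewrite sumEFin ltry.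
(* The constant 2 makes the terms [2 / 2 ^ n.+1] of [epsilon_trick0] equal to [2^-1 ^+ n]. *)
rewrite eseries_cond; apply: le_lt_trans (ltry 2).
apply: le_trans (epsilon_trick0 (fun n => true && (N <= n)%N) (ler0n R 2)).
apply: lee_nneseries => [n _ _|n /= Nn]; first by rewrite lee_fin.
rewrite lee_fin (le_trans (uN n Nn)) // natrX exprS invfM mulrA divff ?mul1r //.
by rewrite exprVn.
Qed.

Lemma nneseries_one (R : realType) : (\sum_(n <oo) (1%:E : \bar R) = +oo)%E.
Proof.
apply/eqP; rewrite eq_le leey /= leNgt; apply/negP => fin.
have S0 n : ((n%:R)%:E <= \sum_(k <oo) (1%:E : \bar R))%E.
  apply: le_trans (nneseries_lim_ge n _) => //.
  by rewrite sumEFin big_const_nat subn0 iter_addr addr0.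
have /fineK Sfin : (\sum_(k <oo) (1%:E : \bar R))%E \is a fin_num.
  by rewrite ge0_fin_numE // (le_trans _ (S0 0%N)).
set r := fine _ in Sfin.
have := S0 (Num.bound `|r|); rewrite -Sfin lee_fin leNgt => /negP; apply.
by rewrite (le_lt_trans (ler_norm r)) // archi_boundP.
Qed.

Section weighted_counting.
Context {R : realType}.
Implicit Types (w : nat -> {nonneg R}).

(** The measure on [nat] with mass [w n] at [n], written as a series of scaled Dirac measures so
    that integrals become series termwise. *)
Definition weighted_counting w : {measure set nat -> \bar R} :=
  mseries (fun n => mscale (w n) (\d_ n)) 0.

Lemma ge0_integral_weighted_counting w (f : nat -> R) : (forall n, 0 <= f n) ->
  (\int[weighted_counting w]_n (f n)%:E = \sum_(n <oo) ((w n)%:num * f n)%:E)%E.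
Proof.
move=> f0; rewrite ge0_integral_measure_series //; last first.
  by move=> n _; rewrite lee_fin.
apply: eq_eseriesr => n _.
rewrite ge0_integral_mscale //; last by move=> k _; rewrite lee_fin.
by rewrite integral_dirac // diracT mul1e EFinM.
Qed.

Lemma Lfun_weighted_counting w (p : R) (f : nat -> R) : 1 <= p ->
  f \in Lfun (weighted_counting w) p%:E <->
  (\sum_(n <oo) ((w n)%:num * `|f n| `^ p)%:E < +oo)%E.
Proof.
move=> p1; rewrite LfunP_powR // ge0_integral_weighted_counting //.
by split => [[]|].
Qed.

End weighted_counting.

Lemma sublinear_preserves_integrability (R : realType) (I : Type)
    (tau : (I -> R) -> R) (p : R) (J : seq I) (lambda : I -> R) (k : R)
    (d : measure_display) (T : measurableType d)
    (mu : {finite_measure set T -> \bar R}) :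
  1 <= p -> measurable_fun [set: cylType R I] (tau : cylType R I -> R) ->
  (forall v, `|tau v| <= k + \sum_(j <- J) lambda j * `|v j|) ->
  preserves_integrability tau p mu.
Proof.
move=> p1 mtau tau_le f Lf.
have mf i : measurable_fun [set: T] (f i).
  by have /LfunP_powR-/(_ p1)[] := Lf i.
(* The dominating function is p-integrable: constants are because [mu] is finite, and
   p-integrability is stable under absolute values, scaling and sums. *)
pose g := cst k + \sum_(j <- J) (fun x => lambda j * `|f j x|) : T -> R.
have : g \in Lfun mu p%:E.
  have [L0 LD] := @Lfun_addr_closed _ _ _ mu p%:E p1.
  apply: (LD); first exact: Lfun_cst.
  elim/big_ind : _; [exact: L0|exact: LD|move=> j _].
  have -> : (fun x => lambda j * `|f j x|) = lambda j \o* (Num.norm \o f j).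
    by apply/funext => x; rewrite /= mulrC.
  apply: Lfun_scale => //; apply/LfunP_powR => //; split.
    exact: measurableT_comp.
  have /LfunP_powR-/(_ p1)[_] := Lf j.
  by under [in X in _ -> X]eq_integral do rewrite /= normr_id.
have mtf : measurable_fun [set: T] (fun x => tau (fun i => f i x)).
  exact: (measurableT_comp mtau (measurable_to_cyl mf)).
have mpow (h : T -> R) : measurable_fun [set: T] h ->
    measurable_fun [set: T] (EFin \o (fun x => `|h x| `^ p)).
  move=> mh; apply/measurable_EFinP.
  apply: (measurableT_comp (measurable_powR p)).
  exact: measurableT_comp.
move=> /LfunP_powR-/(_ p1)[mg ig]; apply/LfunP_powR => //; split => //.
apply: le_lt_trans ig; apply: ge0_le_integral => //.
- exact: mpow.
- exact: mpow.
move=> x _; rewrite lee_fin ge0_ler_powR ?nnegrE // ?(le_trans ler01 p1) //.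
apply: le_trans (tau_le _) (le_trans _ (ler_norm _)).
by rewrite /g fct_sumE.
Qed.

(* Over the zero measure every measurable function is p-integrable, in
   particular every projection. *)
Lemma preserves_integrability_measurable (R : realType) (I : Type)
    (tau : (I -> R) -> R) (p : R) : 1 <= p ->
  preserves_integrability tau p (@mzero _ (cylType R I) R) ->
  measurable_fun [set: cylType R I] (tau : cylType R I -> R).
Proof.
move=> p1 /(_ (fun i v => v i)) tauL.
have /LfunP_powR-/(_ p1)[] // : tau \in Lfun (@mzero _ (cylType R I) R) p%:E.
apply: tauL => i; apply/LfunP_powR => //; split; first exact: measurable_cyl_proj.
by rewrite integral_measure_zero ltry.
Qed.

(** A single [c] serves as additive constant and as every coefficient, so the failure of all bounds
    can be tested at [J n] and [2 ^+ n]. It yields a sequence of points, hence measures on [nat]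
    suffice. *)
Lemma preserves_integrability_sublinear (R : realType) (I : Type)
    (tau : (I -> R) -> R) (p : R) (D : set I) : 1 <= p ->
  countable D -> determined_by D tau ->
  (forall mu : {finite_measure set nat -> \bar R},
     preserves_integrability tau p mu) ->
  exists (J : {fset {classic I}}) (c : R), 0 <= c /\
    forall v : I -> R, `|tau v| <= c + \sum_(j <- J) c * `|v j|.
Proof.
move=> p1 /countable_fset_exhaustion[J DJ] Dtau tauL.
apply: contrapT => unbounded.
have p0 : 0 <= p by exact: le_trans p1.
have /choice[u uP] n : exists v : I -> R,
    2 ^+ n + \sum_(j <- J n) 2 ^+ n * `|v j| < `|tau v|.
  apply: contrapT => nv; apply: unbounded; exists (J n), (2 ^+ n).
  split; first by rewrite exprn_ge0.
  by move=> v; rewrite leNgt; apply/negP => vt; apply: nv; exists v.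
(* The coordinates outside [D] are reset to zero because [u] is only controlled
   along the exhaustion [J] of [D]. *)
pose v n i : R := if `[< D i >] then u n i else 0.
pose t n := `|tau (u n)|.
have tv n : tau (v n) = tau (u n).
  by apply: Dtau => i Di; rewrite /v asboolT.
have sum_ge0 n : 0 <= \sum_(j <- J n) 2 ^+ n * `|u n j|.
  by apply: sumr_ge0 => j _; rewrite mulr_ge0 // exprn_ge0.
have t_ge n : 2 ^+ n <= t n.
  by apply: ltW; apply: le_lt_trans (uP n); rewrite lerDl.
have t_ge1 n : 1 <= t n by rewrite (le_trans _ (t_ge n)) // exprn_ege1 // ler1n.
have t_gt0 n : 0 < t n by exact: lt_le_trans (t_ge1 n).
have t_ge0 n : 0 <= t n by exact: ltW.
have tp_gt0 n : 0 < t n `^ p by rewrite powR_gt0.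
have w_ge0 n : 0 <= (t n `^ p)^-1 by rewrite invr_ge0 ltW.
pose w n : {nonneg R} := NngNum (w_ge0 n).
have mu_fin : fin_num_fun (weighted_counting w).
  apply: lty_fin_num_fun.
  rewrite -[X in (X < _)%E]mul1e -integral_cst //.
  rewrite (@ge0_integral_weighted_counting R w (cst 1) (fun=> ler01)).
  apply: (@eventually_le_geometric_summable _ _ 0) => n /=; first by rewrite mulr1.
  move=> _; rewrite mulr1 exprVn lef_pV2 ?posrE // ?exprn_gt0 //.
  by rewrite (le_trans (t_ge n)) // le1r_powR.
(* Packing adds the finiteness that [tauL] asks for and keeps the underlying measure, so [muE] holds
   by conversion. *)
pose mu_mixin := Measure_isFinite.Build _ _ _ (weighted_counting w) mu_fin.
pose mu : {finite_measure set nat -> \bar R} :=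
  HB.pack (Measure.sort (weighted_counting w)) mu_mixin.
have muE (f : nat -> R) :
    f \in Lfun mu p%:E = (f \in Lfun (weighted_counting w) p%:E) by [].
have : (fun n => tau (fun i => v n i)) \in Lfun mu p%:E.
  apply: (tauL mu (fun i n => v n i)) => i.
  rewrite muE Lfun_weighted_counting //.
  (* For [i] in [D], the left side is eventually a summand of the sum over [J n] in [uP]; otherwise
     [v n i] is zero. *)
  have [N vN] : exists N, forall n, (N <= n)%N -> 2 ^+ n * `|v n i| <= t n.
    have [Di|nDi] := pselect (D i); last first.
      by exists 0%N => n _; rewrite /v asboolF // normr0 mulr0 ltW.
    have [N JN] := DJ i Di; exists N => n Nn.
    apply: ltW; apply: le_lt_trans (uP n).
    rewrite /v asboolT // (bigD1_seq (i : {classic I})) ?fset_uniq ?JN //=.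
    rewrite addrCA lerDl addr_ge0 ?exprn_ge0 //.
    by apply: sumr_ge0 => j _; rewrite mulr_ge0 // exprn_ge0.
  apply: (@eventually_le_geometric_summable _ _ N) => n /=.
    by rewrite mulr_ge0 // powR_ge0.
  move=> Nn; rewrite mulrC ler_pdivrMr //.
  have half0 : 0 < 2^-1 ^+ n :> R by rewrite exprn_gt0.
  (* The factor [t n]^ p[cancels the mass, and](2^-1 ^+ n) [^ p <= 2^-1 ^+ n] since the base is at
     most 1 and [1 <= p]. *)
  apply: (@le_trans _ _ ((2^-1 ^+ n * t n) `^ p)).
    rewrite ge0_ler_powR ?nnegrE ?mulr_ge0 ?(ltW half0) ?t_ge0 //.
    by rewrite exprVn mulrC ler_pdivlMr ?exprn_gt0 // mulrC vN.
  rewrite powRM ?(ltW half0) ?t_ge0 // ler_wpM2r ?(ltW (tp_gt0 n)) // ge1r_powR // half0.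
  by rewrite exprn_ile1 // invf_le1 // ler1n.
rewrite muE Lfun_weighted_counting //.
under eq_eseriesr do rewrite tv /= mulVf ?gt_eqF //.
by rewrite nneseries_one ltxx.
Qed.

Theorem theorem2p2 (R : realType) (I : Type) (tau : (I -> R) -> R) (p : R)
    (hp : 1 <= p) :
  (forall (d : measure_display) (T : measurableType d)
     (mu : {finite_measure set T -> \bar R}),
     preserves_integrability tau p mu)
  <->
  (measurable_fun [set: cylType R I] (tau : cylType R I -> R) /\
   exists (J : {fset {classic I}}) (lambda : I -> R) (k : R),
     [/\ forall j : I, (j : {classic I}) \in J -> 0 <= lambda j,
         0 <= k
       & forall v : I -> R,
           `|tau v| <= k + \sum_(j <- J) lambda j * `|v j| ]).
Proof.
split=> [tauL|[mtau [J [lambda [k [_ _ tau_le]]]]] d T mu]; last first.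
  exact: sublinear_preserves_integrability tau_le.
(* Measurability comes first, from the zero measure on [cylType R I]: it supplies the countable [D]
   needed for the growth bound. *)
have mtau : measurable_fun [set: cylType R I] (tau : cylType R I -> R).
  by apply: preserves_integrability_measurable hp _; exact: tauL.
split=> //; have [D cD Dtau] := measurable_countably_determined mtau.
have [J [c [c0 tau_le]]] :=
  preserves_integrability_sublinear hp cD Dtau (tauL _ _).
by exists J, (fun=> c), c.
Qed.
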